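(* Let $p$ be a prime and let $(\mathcal{A}_p,f)$ be a connected affine quandle of order $p$, where $f(x)=tx$ on $\mathbb{Z}_p$ and $n$ is the order of $f$. For $k\in\mathcal{A}_p=\mathbb{Z}_p$ put $$A(k)=\{(i,i+tk),(i,i+t^2k),\dots,(i,i+t^nk)\mid i\in\mathcal{A}_p\}\subseteq\mathcal{A}_p\times\mathcal{A}_p.$$ Then the tensor product $\mathcal{A}_p\otimes\mathcal{A}_p$ consists of $1+(p-1)/n$ elements of the form $A(k)$, $k\in\mathcal{A}_p$; that is, $\mathcal{A}_p\otimes\mathcal{A}_p=\{A(k)\mid k\in\mathcal{A}_p\}$ (as a set of equivalence classes, i.e. subsets of $\mathcal{A}_p\times\mathcal{A}_p$), and this set has exactly $1+(p-1)/n$ elements.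
   Context: A quandle is a set $X$ with a binary operation $\triangleright$ such that $x\triangleright x=x$; for all $x,y$ there is a unique $z$ with $x=z\triangleright y$ (this $z$ is denoted $x\triangleright^{-1}y$); and $(x\triangleright y)\triangleright z=(x\triangleright z)\triangleright(y\triangleright z)$. $Inn(X)$ is the group of permutations of $X$ generated by the maps $R_y(x)=x\triangleright y$; $X$ is connected if $Inn(X)$ acts transitively on $X$. For $t\in\mathbb{Z}_p^{\ast}$ and $f(x)=tx$, $(\mathcal{A}_p,f)$ is the affine quandle on $\mathbb{Z}_p$ with $x\triangleright y=tx+(1-t)y$; the order $n$ of $f$ is the least $n\in\mathbb{N}$ with $t^n\equiv1\pmod p$. Let $F(X)$ be the free group on the set $X$. It acts on $X$ on the right by $x\cdot g=((x\triangleright^{\epsilon_1}x_1)\triangleright^{\epsilon_2}x_2\cdots)\triangleright^{\epsilon_m}x_m$ for $g=x_1^{\epsilon_1}\cdots x_m^{\epsilon_m}$ with $\epsilon_i=\pm1$, $\triangleright^{1}=\triangleright$, and on the left by $g\cdot x=x\cdot g^{-1}$. The (canonical) tensor product $X\otimes X$ is the set of equivalence classes $[(x,y)]$ of $X\times X$ under the equivalence relation generated by $(x\cdot g,y)\sim(x,g\cdot y)$ for $x,y\in X$, $g\in F(X)$. Equivalently, $X\otimes X$ is the set of orbits of $Inn(X)$ acting diagonally on $X\times X$. *)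

(* Defs.v *)
From HB Require Import structures.
From Stdlib Require Import Relation_Operators.
From mathcomp Require Import all_boot all_algebra all_fingroup.
From mathcomp Require Import boolp ring.

Set Implicit Arguments.
Unset Strict Implicit.
Unset Printing Implicit Defensive.

Import GRing.Theory.
Local Open Scope ring_scope.

Reserved Notation "x ▷ y" (at level 40, left associativity).
Reserved Notation "x ▷^-1 y" (at level 40, left associativity).

(* The free group F(X), realized on reduced words.  The letter (x, true)      *)
(* stands for x and (x, false) for x^-1.                                      *)
Section FreeGroup.
Variable X : choiceType.

Local Notation letter := (X * bool)%type.

Definition linv (a : letter) : letter := (a.1, ~~ a.2).

Definition reduced (w : seq letter) := sorted (fun a b => b != linv a) w.

Record free_group := FreeGroup {
  fgword :> seq letter;
  fgwordP : reduced fgword }.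
HB.instance Definition _ := [isSub for fgword].
HB.instance Definition _ := [Choice of free_group by <:].

(* [lcons a w] is the reduced form of [a :: w]. *)
Definition lcons (a : letter) (w : seq letter) :=
  if w is b :: w' then if b == linv a then w' else a :: w else [:: a].

Definition mulw (u v : seq letter) := foldr lcons v u.
Definition invw (u : seq letter) := rev (map linv u).

Lemma linvK : involutive linv.
Proof. by case=> x b; rewrite /linv negbK. Qed.

Lemma reduced_behead a w : reduced (a :: w) -> reduced w.
Proof. exact: path_sorted. Qed.

Lemma reduced_lcons a w : reduced w -> reduced (lcons a w).
Proof.
case: w => //= b w; case: ifPn => [_|nba]; first exact: path_sorted.
by rewrite /= nba.
Qed.

Lemma lconsK a w : reduced w -> lcons (linv a) (lcons a w) = w.
Proof.
case: w => [|b w] /=; first by rewrite linvK eqxx.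
case: ifPn => [/eqP->|_ _] /=; last by rewrite linvK eqxx.
by case: w => [|c w] //= /andP[/negPf ->].
Qed.

Lemma lcons_reduced a w : reduced (a :: w) -> lcons a w = a :: w.
Proof. by case: w => //= b w /andP[/negPf ->]. Qed.

Lemma reduced_mulw u v : reduced v -> reduced (mulw u v).
Proof. by move=> rv; elim: u => //= a u; apply: reduced_lcons. Qed.

Lemma reduced_invw u : reduced u -> reduced (invw u).
Proof.
rewrite /reduced /invw rev_sorted sorted_map; apply: sub_sorted => a b /=.
by rewrite linvK; apply: contraNneq => ->.
Qed.

Lemma mulw_lcons a u w : reduced w -> mulw (lcons a u) w = lcons a (mulw u w).
Proof.
move=> rw; case: u => [|b u] //=; case: ifPn => //= /eqP->.
by have := lconsK (linv a) (reduced_mulw u rw); rewrite linvK.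
Qed.

Lemma mulwA u v w : reduced w -> mulw u (mulw v w) = mulw (mulw u v) w.
Proof. by move=> rw; elim: u => //= a u ->; rewrite mulw_lcons. Qed.

Lemma mulw1 u : reduced u -> mulw u [::] = u.
Proof.
by elim: u => //= a u IHu ru; rewrite IHu ?lcons_reduced ?(reduced_behead ru).
Qed.

Lemma mulVw u : mulw (invw u) u = [::].
Proof.
elim: u => //= a u IHu.
by rewrite /invw /= rev_cons /mulw foldr_rcons /= linvK eqxx.
Qed.

Lemma invwK : involutive invw.
Proof.
move=> u; rewrite /invw map_rev revK -map_comp map_id_in // => a _ /=.
exact: linvK.
Qed.

Definition fg1 : free_group := @FreeGroup [::] isT.
Definition fgmul (g h : free_group) : free_group :=
  FreeGroup (reduced_mulw g (fgwordP h)).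
Definition fginv (g : free_group) : free_group :=
  FreeGroup (reduced_invw (fgwordP g)).

Fact fgmulA : associative fgmul.
Proof. by move=> u v w; apply/val_inj/mulwA/fgwordP. Qed.
Fact fgmul1g : left_id fg1 fgmul.
Proof. by move=> u; apply/val_inj. Qed.
Fact fgmulg1 : right_id fg1 fgmul.
Proof. by move=> u; apply/val_inj/mulw1/fgwordP. Qed.
Fact fgmulVg : left_inverse fg1 fginv fgmul.
Proof. by move=> u; apply/val_inj/mulVw. Qed.
Fact fgmulgV : right_inverse fg1 fginv fgmul.
Proof. by move=> u; apply/val_inj; rewrite /= -[X in mulw X _]invwK mulVw. Qed.

HB.instance Definition _ :=
  isGroup.Build free_group fgmulA fgmul1g fgmulg1 fgmulVg fgmulgV.

Definition fgen (x : X) : free_group := @FreeGroup [:: (x, true)] isT.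

End FreeGroup.

HB.mixin Record isQuandle X := {
  qop : X -> X -> X;
  qopxx : forall x, qop x x = x;
  qop_divP : forall x y, exists! z, x = qop z y;
  qopD : forall x y z, qop (qop x y) z = qop (qop x z) (qop y z) }.

#[short(type="quandleType")]
HB.structure Definition Quandle := {X of isQuandle X & Choice X}.

#[short(type="finQuandleType")]
HB.structure Definition FinQuandle := {X of Quandle X & Finite X}.

Notation "x ▷ y" := (qop x y).

Section QuandleTheory.
Variable X : quandleType.
Implicit Types (x y : X) (g : free_group X).

Definition qdiv x y : X := sval (cid (qop_divP x y)).
Local Notation "x ▷^-1 y" := (qdiv x y).

Lemma qdivK x y : (x ▷^-1 y) ▷ y = x.
Proof. by rewrite /qdiv; case: cid => z /= [<-]. Qed.

Lemma qop_inj y : injective (fun x => x ▷ y).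
Proof.
move=> a b /= eqab; have [c [_ uc]] := qop_divP (a ▷ y) y.
by rewrite -(uc a) // -(uc b).
Qed.

Lemma qopK x y : (x ▷ y) ▷^-1 y = x.
Proof. by apply: (@qop_inj y); rewrite /= qdivK. Qed.

Definition letter_act x (a : X * bool) : X :=
  if a.2 then x ▷ a.1 else x ▷^-1 a.1.

(* x . g *)
Definition act_right x g : X := foldl letter_act x (fgword g).
(* g . x *)
Definition act_left g x : X := act_right x g^-1%g.

Lemma act_right1 x : act_right x 1%g = x.
Proof. by []. Qed.

Lemma act_rightM x g h : act_right x (g * h)%g = act_right (act_right x g) h.
Proof.
rewrite /act_right /=; elim: (fgword g) x => //= a u IHu x; rewrite -IHu.
case: (mulw u (fgword h)) => [|b w] //=; case: ifPn => //= /eqP->.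
by case: a => y [] /=; rewrite /letter_act /= ?qopK ?qdivK.
Qed.

Inductive tensor_step : X * X -> X * X -> Prop :=
  TensorStep x y g : tensor_step (act_right x g, y) (x, act_left g y).

Definition tensor_equiv : X * X -> X * X -> Prop :=
  clos_refl_sym_trans (X * X) tensor_step.

End QuandleTheory.

Notation "x ▷^-1 y" := (qdiv x y).

Section FinQuandleTheory.
Variable X : finQuandleType.

Definition translation (y : X) : {perm X} := perm (@qop_inj X y).

Definition Inn : {group {perm X}} := <<[set translation y | y : X]>>%G.

Definition connected : bool := [transitive Inn, on [set: X] | 'P].

Definition tensor : {set {set X * X}} :=
  equivalence_partition (fun u v => `[< tensor_equiv u v >]) [set: X * X].

End FinQuandleTheory.

Arguments Inn X : clear implicits.
Arguments connected X : clear implicits.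
Arguments tensor X : clear implicits.

(* 'F_p is Z_p when p is prime; {unit 'F_p} is then Z_p^*. *)
Definition affine (p : nat) (t : {unit 'F_p}) : Type := 'F_p.

Section Affine.
Variables (p : nat) (t : {unit 'F_p}).

HB.instance Definition _ := Finite.copy (affine t) 'F_p.

Definition affine_op (x y : affine t) : affine t :=
  val t * (x : 'F_p) + (1 - val t) * (y : 'F_p).

Fact affine_opxx x : affine_op x x = x.
Proof. by rewrite /affine_op -mulrDl addrC subrK mul1r. Qed.

Fact affine_op_divP x y : exists! z, x = affine_op z y.
Proof.
exists ((val t)^-1 * ((x : 'F_p) - (1 - val t) * (y : 'F_p)) : 'F_p).
split=> [|z ->]; first by rewrite /affine_op mulVKr ?(valP t) // subrK.
by rewrite /affine_op addrK mulKr ?(valP t).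
Qed.

Fact affine_opD x y z :
  affine_op (affine_op x y) z = affine_op (affine_op x z) (affine_op y z).
Proof.
by rewrite /affine_op; ring.
Qed.

HB.instance Definition _ :=
  isQuandle.Build (affine t) affine_opxx affine_op_divP affine_opD.

End Affine.

Definition is_order (p : nat) (t : 'F_p) (n : nat) : Prop :=
  [/\ (0 < n)%N, t ^+ n = 1
    & forall m : nat, (0 < m)%N -> t ^+ m = 1 -> (n <= m)%N].

(* The exponent runs over 1, ..., n. *)
Definition A (p : nat) (t : 'F_p) (n : nat) (k : 'F_p) : {set 'F_p * 'F_p} :=
  [set (i, i + t ^+ j.+1 * k) | i : 'F_p, j : 'I_n].

(* Main.v *)
Require Import Defs.
From Stdlib Require Import Relation_Operators.
From mathcomp Require Import all_boot all_algebra all_fingroup.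
From mathcomp Require Import boolp ring.

(** Two pairs are identified in the tensor product exactly when some word [g]
    carries one to the other diagonally.  In the affine quandle a translation
    sends [x] to [t x + (1 - t) z], so it multiplies every difference [y - x]
    by [t]: the class of [y - x] modulo the powers of [t] is an invariant
    ([act_right_sub], [tensor_equiv_sub]).  This invariant is complete.
    Connectedness forces [t != 1], hence a single translation can move the
    first coordinate anywhere, while translating by the first coordinate
    itself keeps it in place and scales the difference by [t]
    ([tensor_equiv_scale]).  The class of [(x, y)] is therefore
    [A t n (y - x)].

    As [t] is a primitive [n]-th root of unity, [A t n k] has [p * n] elements
    for [k != 0], and [A t n 0] is the diagonal, with [p] elements.  Since the
    classes partition a set of [p * p] pairs, there are [(p - 1) / n] of them
    besides the diagonal. *)

Set Implicit Arguments.
Unset Strict Implicit.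
Unset Printing Implicit Defensive.

Import GRing.Theory.
Local Open Scope ring_scope.

Lemma is_order_prim_root (p : nat) (t : 'F_p) (n : nat) :
  is_order t n -> n.-primitive_root t.
Proof.
case=> n_gt0 tn1 n_min; rewrite /primitive_root_of_unity n_gt0 /=.
apply/forallP=> i; rewrite unity_rootE; apply/eqP.
by apply/eqP/eqP=> [ti1|->//]; apply/eqP; rewrite eqn_leq ltn_ord n_min.
Qed.

(** Over a primitive root of unity all powers, including the zeroth one, are
    reached by the exponents [1, ..., n] that index [A]. *)
Lemma prim_root_exprS (F : fieldType) (t : F) (n : nat) (m : nat) :
  n.-primitive_root t -> exists j : 'I_n, t ^+ m = t ^+ j.+1.
Proof.
move=> prim_t; have n_gt0 := prim_order_gt0 prim_t.
exists (Ordinal (ltn_pmod (m + n.-1) n_gt0)) => /=.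
rewrite exprS (prim_expr_mod prim_t) -exprS -addnS prednK //.
by rewrite exprD (prim_expr_order prim_t) mulr1.
Qed.

Lemma tensor_equiv_qop (X : quandleType) (x y z : X) :
  tensor_equiv (x ▷ z, y ▷ z) (x, y).
Proof.
apply: rst_step; have := TensorStep x (y ▷ z) (fgen z).
by rewrite /act_left /act_right /= /letter_act /= qopK.
Qed.

Lemma partition_tensor (Y : finQuandleType) :
  partition (tensor Y) [set: Y * Y].
Proof.
apply/equivalence_partitionP => u v w _ _ _; split.
  exact/asboolP/rst_refl.
move=> /asboolP uv; apply/asboolP/asboolP; last exact: rst_trans.
by apply: rst_trans; apply: rst_sym.
Qed.

Section AffineTensor.
Variables (p : nat) (t : {unit 'F_p}) (n : nat).
Hypothesis prim_t : n.-primitive_root (val t).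
Local Notation X := (affine t).
Local Notation s := (val t : 'F_p).
Implicit Types x y z : 'F_p.

Lemma affine_qopE x z : (x : X) ▷ z = s * x + (1 - s) * z :> 'F_p.
Proof. by []. Qed.

Lemma affine_qop_sub x y z :
  ((y : X) ▷ z : 'F_p) - ((x : X) ▷ z : 'F_p) = s * (y - x).
Proof. by rewrite !affine_qopE; ring. Qed.

Lemma affine_letter_sub (a : X * bool) : exists m : nat, forall x y,
  (letter_act (y : X) a : 'F_p) - (letter_act (x : X) a : 'F_p)
  = s ^+ m * (y - x).
Proof.
case: a => z [] /=; first by exists 1%N => x y; rewrite expr1 affine_qop_sub.
(* the inverse of [s] is itself a power of [s] *)
exists n.-1 => x y; rewrite /letter_act /=.
rewrite -[in RHS](qdivK (y : X) z) -[in RHS](qdivK (x : X) z) affine_qop_sub.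
rewrite mulrA -exprSr prednK ?(prim_order_gt0 prim_t) //.
by rewrite (prim_expr_order prim_t) mul1r.
Qed.

Lemma act_right_sub (g : free_group X) : exists m : nat, forall x y,
  (act_right (y : X) g : 'F_p) - (act_right (x : X) g : 'F_p)
  = s ^+ m * (y - x).
Proof.
rewrite /act_right; elim: (fgword g) => [|a w [m IHw]] /=.
  by exists 0%N => x y; rewrite expr0 mul1r.
have [l a_sub] := affine_letter_sub a.
by exists (m + l)%N => x y; rewrite IHw a_sub exprD mulrA.
Qed.

Lemma tensor_equiv_sub (u v : X * X) : tensor_equiv u v ->
  exists m : nat, (v.2 : 'F_p) - (v.1 : 'F_p)
                  = s ^+ m * ((u.2 : 'F_p) - (u.1 : 'F_p)).
Proof.
elim=> {u v} [_ _ [x y g]|u|u v _ [m uv]|u v w _ [m uv] _ [l vw]] /=.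
- have [m g_sub] := act_right_sub g^-1%g.
  exists m; rewrite -g_sub; congr (_ - _).
  by rewrite -act_rightM mulgV act_right1.
- by exists 0%N; rewrite expr0 mul1r.
- (* [s ^+ (m * n.-1)] is the inverse of [s ^+ m] *)
  exists (m * n.-1)%N; rewrite uv mulrA -exprD addnC -mulnS.
  by rewrite prednK ?(prim_order_gt0 prim_t) // mulnC exprM
             (prim_expr_order prim_t) expr1n mul1r.
- by exists (l + m)%N; rewrite vw uv exprD mulrA.
Qed.

(** For [t = 1] every translation is the identity, so no inner automorphism
    moves [0] to [1]. *)
Lemma connected_affine_neq1 : connected X -> s != 1.
Proof.
move=> /atransP/(_ (0 : 'F_p) (in_setT _)) orb0.
have := in_setT ((1 : 'F_p) : X); rewrite -orb0 => /orbitP[a Inn_a].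
apply: contra_eqN => /eqP s1.
have /subsetP/(_ a Inn_a): Inn X \subset [1 {perm X}]%G.
  rewrite gen_subG; apply/subsetP=> _ /imsetP[z _ ->]; rewrite inE.
  apply/eqP/permP=> x; rewrite permE perm1 [LHS]affine_qopE s1.
  by rewrite subrr mul0r addr0 mul1r.
by rewrite inE => /eqP->; rewrite /= /aperm perm1 eq_sym; apply: oner_neq0.
Qed.

(** Translating [m] times by [x] itself scales the difference without moving
    [x]; the remaining translation, whose centre solves
    [s * x + (1 - s) * z = i], places the first coordinate. *)
Lemma tensor_equiv_scale x y i m : s != 1 ->
  tensor_equiv (x : X, y : X) (i : X, i + s ^+ m.+1 * (y - x) : X).
Proof.
move=> s_neq1.
have fix_x l : tensor_equiv (x : X, y : X) (x : X, x + s ^+ l * (y - x) : X).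
  elim: l => [|l IHl]; first by rewrite expr0 mul1r addrC subrK; apply: rst_refl.
  apply: rst_trans IHl _; apply: rst_sym.
  have := tensor_equiv_qop (x : X) (x + s ^+ l * (y - x) : X) (x : X).
  congr tensor_equiv; congr pair; first exact: qopxx.
  by rewrite affine_qopE exprS; ring.
apply: rst_trans (fix_x m) _; apply: rst_sym.
have s1_neq0 : 1 - s != 0 by rewrite subr_eq0 eq_sym.
pose z := (i - s * x) / (1 - s).
have z_def : (1 - s) * z = i - s * x by rewrite mulrC divfK.
have := tensor_equiv_qop (x : X) (x + s ^+ m * (y - x) : X) (z : X).
congr tensor_equiv; congr pair; rewrite affine_qopE z_def.
  by rewrite addrC subrK.
by rewrite exprS; ring.
Qed.

Lemma tensor_equivE x y (v : X * X) : s != 1 ->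
  tensor_equiv (x : X, y : X) v <-> v \in A s n (y - x).
Proof.
move=> s_neq1; split=> [/tensor_equiv_sub[m /= v_sub]|].
  have [j sj] := prim_root_exprS m prim_t.
  apply/imset2P; exists (v.1 : 'F_p) j => //.
  by rewrite -sj -v_sub addrC subrK; case: (v).
by case/imset2P=> i j _ _ ->; apply: tensor_equiv_scale.
Qed.

Lemma tensor_affineE : s != 1 -> tensor X = [set A s n k | k : 'F_p].
Proof.
move=> s_neq1.
have class x y : [set v in [set: X * X] | `[< tensor_equiv (x : X, y : X) v >]]
                 = A s n (y - x).
  apply/setP=> v; rewrite !inE /=.
  by apply/asboolP/idP => /(tensor_equivE x y v s_neq1).
apply/setP=> B; apply/imsetP/imsetP=> [[[x y] _ ->]|[k _ ->]].
  by exists ((y : 'F_p) - (x : 'F_p)) => //; apply: class.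
by exists (((0 : 'F_p), k) : X * X); rewrite ?inE // class subr0.
Qed.

Lemma card_A0 : #|A s n 0| = #|'F_p|.
Proof.
have -> : A s n 0 = [set (i, i) | i : 'F_p].
  apply/setP=> u; apply/imset2P/imsetP=> [[i j _ _ ->]|[i _ ->]].
    by exists i; rewrite // mulr0 addr0.
  exists i (Ordinal (prim_order_gt0 prim_t)) => //.
  by rewrite mulr0 addr0.
by rewrite card_imset // => i j [].
Qed.

Lemma card_A (k : 'F_p) : k != 0 -> #|A s n k| = (#|'F_p| * n)%N.
Proof.
move=> k_neq0; pose f (u : 'F_p * 'I_n) := (u.1, u.1 + s ^+ u.2.+1 * k).
have -> : A s n k = [set f u | u : 'F_p * 'I_n].
  apply/setP=> v; apply/imset2P/imsetP=> [[i j _ _ ->]|[[i j] _ ->]].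
    by exists (i, j).
  by exists i j.
rewrite card_imset ?card_prod ?card_ord // => -[i j] [i' j'].
move=> /eqP; rewrite xpair_eqE /= => /andP[/eqP<- /eqP/addrI/(mulIf k_neq0)/eqP].
rewrite (eq_prim_root_expr prim_t).
by rewrite -addn1 -[j'.+1]addn1 eqn_modDr !modn_small // => /eqP/val_inj->.
Qed.

(** The block [A s n 0] has [p] elements and each of the others [p * n], so
    comparing cardinals in the partition of all pairs gives
    [p * p = p + (#|tensor X| - 1) * (p * n)]. *)
Lemma card_tensor_affine : prime p -> s != 1 ->
  (1 + #|tensor X|.-1 * n = p)%N /\ (0 < #|tensor X|)%N.
Proof.
move=> p_prime s_neq1; have Fp := card_Fp p_prime.
have A0_in : A s n 0 \in tensor X by rewrite tensor_affineE // imset_f.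
have tensor_gt0 : (0 < #|tensor X|)%N by apply/card_gt0P; exists (A s n 0).
split=> //; have := card_partition (partition_tensor X).
rewrite cardsT card_prod (bigD1 (A s n 0)) //= card_A0 Fp.
rewrite (eq_bigr (fun=> p * n)%N) => [|B /andP[]]; last first.
  rewrite tensor_affineE // => /imsetP[k _ ->] Ak_neq.
  by rewrite card_A ?Fp //; apply: contraNneq Ak_neq => ->.
rewrite sum_nat_const.
have -> : #|[pred B in tensor X | B != A s n 0]| = #|tensor X|.-1.
  rewrite (cardsD1 (A s n 0)) A0_in /=; apply: eq_card => B.
  by rewrite !inE andbC.
rewrite mulnCA -{3}[p]muln1 -mulnDr => /eqP.
by rewrite eqn_pmul2l ?prime_gt0 // => /eqP.
Qed.

End AffineTensor.

(* Cardinality is stated in rat, so that (p - 1) / n is the exact quotient. *)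
Theorem theorem7p8 (p : nat) (t : {unit 'F_p}) (n : nat) :
  prime p -> is_order (val t) n -> connected (affine t) ->
  tensor (affine t) = [set A (val t) n k | k : 'F_p] /\
  #|tensor (affine t)|%:R = 1 + (p%:R - 1) / n%:R :> rat.
Proof.
move=> p_prime /is_order_prim_root prim_t /connected_affine_neq1 t_neq1.
split; first exact: tensor_affineE.
have [card_p card_gt0] := card_tensor_affine prim_t p_prime t_neq1.
have n_neq0 : n%:R != 0 :> rat.
  by rewrite Num.Theory.pnatr_eq0 -lt0n (prim_order_gt0 prim_t).
move/(congr1 (fun m => m%:R : rat)): card_p; rewrite natrD natrM => <-.
rewrite addrAC subrr add0r mulfK //.
by rewrite -(natrD _ 1) add1n prednK.
Qed.
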